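(* Let $(\theta_n)_{n\in\mathbb{N}_0}$ be the dynamical system defined in the context and put $v_n=\sqrt{\gamma_n}\,\sigma_n$. Assume: (a) there exist $L,L'\in(0,\infty)$ such that for all $\theta\in\mathbb{R}^d$: $\langle\theta-\theta^*,f(\theta)\rangle\le-L\|\theta-\theta^*\|^2$ and $\langle\theta-\theta^*,f(\theta)\rangle\le-L'\|f(\theta)\|^2$; (b) $\sup_{n\in\mathbb{N}}\operatorname{ess\,sup}\|R_n\|<\infty$ and $\sup_{n\in\mathbb{N}}\mathbb{E}[\|D_n\|^p]<\infty$; (c) $v_n>0$ for all $n\in\mathbb{N}$, $\limsup_{n\to\infty}\frac{\varepsilon_n}{v_n}<\infty$, and, with $L$ from (a), $\limsup_{n\to\infty}\frac1{\gamma_n}\frac{v_{n-1}-v_n}{v_{n-1}}<L$. Then there exists $\kappa\in(0,\infty)$ such that for all $n\in\mathbb{N}$ \[ \mathbb{E}\bigl[\|\theta_n-\theta^*\|^p\bigr]^{1/p}\le\kappa\,v_n . \]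
   Context: Fix $p\in[2,\infty)$, a probability space $(\Omega,\mathcal{F},P)$ with a filtration $(\mathcal{F}_n)_{n\in\mathbb{N}_0}$, a scalar product $\langle\cdot,\cdot\rangle$ on $\mathbb{R}^d$ with induced norm $\|\cdot\|$, and a measurable function $f\colon\mathbb{R}^d\to\mathbb{R}^d$ with a unique zero $\theta^*\in\mathbb{R}^d$. The adapted $\mathbb{R}^d$-valued dynamical system $(\theta_n)_{n\in\mathbb{N}_0}$ is defined by a fixed deterministic $\theta_0\in\mathbb{R}^d$ and \[ \theta_n=\theta_{n-1}+\gamma_n\bigl(f(\theta_{n-1})+\varepsilon_nR_n+\sigma_nD_n\bigr),\qquad n\in\mathbb{N}, \] where $(R_n)_{n\in\mathbb{N}}$ is an $\mathbb{R}^d$-valued previsible process ($R_n$ is $\mathcal{F}_{n-1}$-measurable), $(D_n)_{n\in\mathbb{N}}$ is a sequence of $\mathbb{R}^d$-valued martingale differences with respect to $(\mathcal{F}_n)$, $(\gamma_n)_{n\in\mathbb{N}}$ is a sequence of positive reals tending to zero, and $(\varepsilon_n)_{n\in\mathbb{N}}$, $(\sigma_n)_{n\in\mathbb{N}}$ are sequences of non-negative reals. *)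

(* Defs.v *)
From HB Require Import structures.
From mathcomp Require Import all_boot all_order all_algebra sesquilinear.
From mathcomp Require Import all_classical all_reals all_analysis.

Set Implicit Arguments.
Unset Strict Implicit.
Unset Printing Implicit Defensive.

Import Order.TTheory GRing.Theory Num.Theory.
Import numFieldNormedType.Exports.

Local Open Scope classical_set_scope.
Local Open Scope ring_scope.

(* R^d is 'rV[R]_d. For theta = idfun, the library type
   {dot 'rV[R]_d for idfun} consists of the symmetric, bilinear, positive
   definite forms, i.e. of the scalar products on R^d. *)
Definition ipnorm (R : realType) (d : nat) (ip : {dot 'rV[R]_d for idfun})
  (x : 'rV[R]_d) : R := Num.sqrt (ip x x).

(* All norms on R^d induce the library's topology on 'rV[R]_d, so this does
   not depend on the choice of a scalar product. *)
Definition borel_rV (R : realType) (d : nat) : set (set 'rV[R]_d) :=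
  <<s [set A : set 'rV[R]_d | open A] >>.

(* Sigma-algebras on T are sets of sets, so that several of them can be
   considered on the same type. *)
Definition measurable_wrt (T : Type) (G : set (set T)) (R : realType)
    (d : nat) (X : T -> 'rV[R]_d) : Prop :=
  forall B, borel_rV B -> G (X @^-1` B).

Definition filtration (disp : measure_display) (T : measurableType disp)
    (F : nat -> set (set T)) : Prop :=
  [/\ forall n, sigma_algebra [set: T] (F n),
      forall n, F n `<=` measurable &
      forall m n, (m <= n)%N -> F m `<=` F n].

Definition adapted (T : Type) (F : nat -> set (set T)) (R : realType)
    (d : nat) (X : nat -> T -> 'rV[R]_d) : Prop :=
  forall n, measurable_wrt (F n) (X n).

(* Processes indexed by {1, 2, ...} are functions on nat whose value at 0 is
   irrelevant. *)
Definition previsible (T : Type) (F : nat -> set (set T)) (R : realType)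
    (d : nat) (X : nat -> T -> 'rV[R]_d) : Prop :=
  forall n, measurable_wrt (F n) (X n.+1).

(* Y is a version of the conditional expectation E[X | G], where G is a
   sub-sigma-algebra of the measurable sets of T. *)
Definition is_cond_expectation (disp : measure_display)
    (T : measurableType disp) (R : realType) (P : probability T R)
    (G : set (set T)) (X Y : T -> R) : Prop :=
  [/\ P.-integrable [set: T] (EFin \o X),
      P.-integrable [set: T] (EFin \o Y),
      forall B : set R, measurable B -> G (Y @^-1` B) &
      forall A, G A ->
        (\int[P]_(w in A) (X w)%:E = \int[P]_(w in A) (Y w)%:E)%E].

(* Integrability and conditional expectation of R^d-valued random variables
   are understood coordinatewise. *)
Definition martingale_differences (disp : measure_display)
    (T : measurableType disp) (R : realType) (P : probability T R)
    (F : nat -> set (set T)) (d : nat) (D : nat -> T -> 'rV[R]_d) : Prop :=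
  forall n, measurable_wrt (F n.+1) (D n.+1) /\
    forall i : 'I_d,
      is_cond_expectation P (F n) (fun w => D n.+1 w ord0 i) (fun=> 0).

Definition noise_scale (R : realType) (gamma sigma : nat -> R) (n : nat) : R :=
  Num.sqrt (gamma n) * sigma n.

(* Main.v *)
(* Write X_n = theta_n - thetastar and X_{n+1} = Y_n + sqrt(gamma) v D_{n+1},
   where Y_n collects the drift and the previsible perturbation. Expanding
   |Y + Z|^p to second order, the first-order term has mean zero because D is a
   martingale difference, and Young's inequality turns the remainder into
     E|X_{n+1}|^p <= (1 + gamma eta) E|Y_n|^p + gamma C v^p E|D_{n+1}|^p
   with eta > 0 arbitrary. Condition (a) makes the drift contract by
   1 - gamma L1 for any L1 < L and small gamma, while (c) gives
   v_{n+1} >= (1 - gamma L2) v_n with some L2 < L; taking L2 < L1 < L and using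
   convexity of t^p, the quotients U_n = E|X_n|^p / v_n^p satisfy
     U_{n+1} <= (1 - gamma (L1 - L2) / 2) U_n + gamma C'
   for large n and hence stay bounded; finitely many n are covered by the
   finiteness of all p-th moments. *)

Require Import Defs.
From HB Require Import structures.
From mathcomp Require Import all_boot all_order all_algebra sesquilinear.
From mathcomp Require Import all_classical all_reals all_analysis ess_sup_inf.
From mathcomp Require Import measurable_realfun ring lra.

Set Implicit Arguments.
Unset Strict Implicit.
Unset Printing Implicit Defensive.

Import Order.TTheory GRing.Theory Num.Theory.
Import numFieldNormedType.Exports.

Local Open Scope classical_set_scope.
Local Open Scope ring_scope.

(** * Real inequalities for [p]-th powers *)

Section power_inequalities.
Context {R : realType}.
Implicit Types p q a b c n s t u x y : R.

(** From [1 - u <= expR (- u)] one gets [(1 - u) * expR u <= 1], while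
    [(1 - u) * (1 + u + 2 * u ^+ 2)] exceeds 1 by [u ^+ 2 * (1 - 2 * u)], which is nonnegative
    here. *)
Lemma expR_le_quadratic u : `|u| <= 2^-1 -> expR u <= 1 + u + 2 * u ^+ 2.
Proof.
rewrite ler_norml => /andP[u1 u2].
have := expR_ge1Dx (- u); rewrite expRN => h.
have e0 := expR_gt0 u.
have h2 : (1 - u) * expR u <= 1.
  by apply: (le_trans (ler_wpM2r (ltW e0) h)); rewrite mulVf// gt_eqF.
have h3 : 1 <= (1 - u) * (1 + u + 2 * u ^+ 2).
  have : 0 <= u ^+ 2 * (1 - 2 * u) by rewrite mulr_ge0 ?sqr_ge0//; lra.
  lra.
have := le_trans h2 h3; rewrite ler_pM2l//; lra.
Qed.

Lemma powR_1D_le q x : 0 <= q -> -1 < x -> `|q * x| <= 2^-1 ->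
  (1 + x) `^ q <= 1 + q * x + 2 * (q * x) ^+ 2.
Proof.
move=> q0 x1 qx; apply: le_trans (expR_le_quadratic qx).
have x10 : 0 < 1 + x by lra.
rewrite /powR gt_eqF// ler_expR ler_wpM2l//.
by have := le_ln1Dx x1.
Qed.

Lemma powRB2 p a : 2 <= p -> 0 <= a -> a `^ (p - 2) * a ^+ 2 = a `^ p.
Proof.
move=> p2 a0; rewrite -(powR_mulrn 2 a0) -powRD ?subrK//.
rewrite gt_eqF//; lra.
Qed.

(* Second-order expansion of [|y + z| `^ p], with [a = |y|], [b = |z|],
   [s = <y, z>] and [n = |y + z|].  When [p = 2] and [a = 0] the factor
   [a `^ (p - 2)] is [0 `^ 0 = 1]. *)
Lemma powR_norm_sqrD_le p : 2 <= p -> exists2 C, 0 <= C &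
  forall a b n s, 0 <= a -> 0 <= b -> 0 <= n -> `|s| <= a * b ->
    n ^+ 2 = a ^+ 2 + 2 * s + b ^+ 2 ->
  n `^ p <= a `^ p + p * (a `^ (p - 2) * s)
            + C * (a `^ (p - 2) * b ^+ 2 + b `^ p).
Proof.
(* [K] is chosen so that [K * b < a] forces the exponent [p / 2 * x] below to have modulus at most
   1/2. The first two summands of [C] pay for the case [a <= K * b], the last one for the other
   case. *)
move=> p2; pose K := 3 * p.
pose C := (1 + K) `^ p + p * (K `^ (p - 2) * K) + (9 * p ^+ 2 + p).
have p0 : 0 <= p by lra.
exists C; first by rewrite /C !addr_ge0 ?mulr_ge0 ?powR_ge0 ?sqr_ge0// /K; lra.
move=> a b n s a0 b0 n0 sab nE.
have K0 : 0 <= K by rewrite /K; lra.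
have t0 := powR_ge0 a (p - 2).
have b20 := sqr_ge0 b; have bp0 := powR_ge0 b p.
(* If [a <= K * b], every term is controlled by [b `^ p]. Otherwise
   [n ^+ 2 = a ^+ 2 * (1 + x)] with [x] small, and [powR_1D_le] applies. *)
have [aKb|aKb] := leP a (K * b).
  have nab : n <= (1 + K) * b.
    rewrite -(@ler_pXn2r _ 2) ?nnegrE// ?mulr_ge0//; last by lra.
    rewrite nE; move: sab; rewrite ler_norml => /andP[_ sab].
    have : a * b <= K * b * b by rewrite ler_wpM2r.
    have : a ^+ 2 <= (K * b) ^+ 2 by rewrite ler_sqr ?nnegrE// mulr_ge0.
    nra.
  have h1 : n `^ p <= (1 + K) `^ p * b `^ p.
    rewrite -powRM//; last by lra.
    by rewrite ge0_ler_powR ?nnegrE ?mulr_ge0//; lra.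
  have h2 : - (a `^ (p - 2) * s) <= K `^ (p - 2) * K * b `^ p.
    rewrite -mulrN.
    apply: (@le_trans _ _ (a `^ (p - 2) * (K * b ^+ 2))).
      rewrite ler_wpM2l// lerNl; move: sab; rewrite ler_norml => /andP[sab _].
      by apply: le_trans sab; rewrite lerNl opprK expr2 mulrA ler_wpM2r.
    apply: (@le_trans _ _ ((K * b) `^ (p - 2) * (K * b ^+ 2))).
      rewrite ler_wpM2r ?mulr_ge0// ge0_ler_powR ?nnegrE ?mulr_ge0//; lra.
    rewrite powRM// -(powRB2 p2 b0) le_eqVlt; apply/orP; left; apply/eqP; ring.
  have h3 : 0 <= a `^ p by exact: powR_ge0.
  have h4 : 0 <= a `^ (p - 2) * b ^+ 2 by rewrite mulr_ge0.
  have h5 : C * b `^ p <= C * (a `^ (p - 2) * b ^+ 2 + b `^ p).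
    rewrite ler_wpM2l ?lerDr// /C !addr_ge0 ?mulr_ge0 ?powR_ge0 ?sqr_ge0//; lra.
  have h6 : p * - (a `^ (p - 2) * s) <= p * (K `^ (p - 2) * K * b `^ p).
    by rewrite ler_wpM2l.
  have h7 : C * b `^ p = (1 + K) `^ p * b `^ p + p * (K `^ (p - 2) * K * b `^ p)
     + (9 * p ^+ 2 + p) * b `^ p by rewrite /C; ring.
  have h8 : 0 <= (9 * p ^+ 2 + p) * b `^ p.
    by rewrite mulr_ge0// addr_ge0// mulr_ge0// sqr_ge0.
  lra.
have ap : 0 < a by apply: le_lt_trans aKb; rewrite mulr_ge0.
pose x := (2 * s + b ^+ 2) / a ^+ 2.
have xE : a ^+ 2 * x = 2 * s + b ^+ 2.
  by rewrite /x mulrC divfK// gt_eqF// exprn_gt0.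
pose r := b / a.
have rE : b = r * a by rewrite /r divfK// gt_eqF.
have r0 : 0 <= r by rewrite divr_ge0.
have Kr : K * r <= 1.
  by rewrite /r mulrA ler_pdivrMr// mul1r ltW.
have xr : `|x| <= 3 * r.
  rewrite /x normrM [`|_^-1|]ger0_norm ?invr_ge0 ?sqr_ge0//.
  rewrite ler_pdivrMr ?exprn_gt0//; apply: (le_trans (ler_normD _ _)).
  rewrite normrM ger0_norm// (ger0_norm b20).
  have : b * b <= a * b * 1.
    rewrite mulr1 ler_wpM2r// rE ler_piMl//.
    by apply: le_trans Kr; rewrite ler_peMl// /K; lra.
  have -> : 3 * r * a ^+ 2 = 3 * (a * b) by rewrite rE; ring.
  lra.
have qx : `|p / 2 * x| <= 2^-1.
  rewrite normrM ger0_norm; last by lra.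
  have : p / 2 * `|x| <= p / 2 * (3 * r) by rewrite ler_wpM2l//; lra.
  rewrite /K in Kr; lra.
have x1 : -1 < x.
  have : `|x| < 1.
    apply: le_lt_trans xr _.
    have : 2 * (3 * r) <= p * (3 * r) by rewrite ler_wpM2r// mulr_ge0.
    rewrite /K in Kr; lra.
  by rewrite ltr_norml => /andP[].
have := powR_1D_le (_ : 0 <= p / 2) x1 qx; rewrite divr_ge0// => /(_ isT) H.
have np : n `^ p = a `^ p * (1 + x) `^ (p / 2).
  have -> : n `^ p = (n ^+ 2) `^ (p / 2).
    by rewrite -powR_mulrn// -powRrM; congr (_ `^ _); lra.
  have -> : a `^ p = (a ^+ 2) `^ (p / 2).
    by rewrite -powR_mulrn// -powRrM; congr (_ `^ _); lra.
  rewrite -powRM ?sqr_ge0//; last by lra.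
  by congr (_ `^ _); rewrite mulrDr mulr1 xE nE addrA.
have x2 : a ^+ 2 * x ^+ 2 <= 9 * b ^+ 2.
  have : x ^+ 2 <= (3 * r) ^+ 2.
    by rewrite -real_normK ?num_real// ler_sqr ?nnegrE// mulr_ge0.
  rewrite -(@ler_pM2l _ (a ^+ 2)) ?exprn_gt0// => /le_trans; apply.
  by rewrite rE le_eqVlt; apply/orP; left; apply/eqP; ring.
rewrite np; apply: (le_trans (ler_wpM2l (powR_ge0 _ _) H)).
have -> : a `^ p * (1 + p / 2 * x + 2 * (p / 2 * x) ^+ 2) =
  a `^ p + (p / 2) * a `^ (p - 2) * (a ^+ 2 * x)
   + p ^+ 2 / 2 * a `^ (p - 2) * (a ^+ 2 * x ^+ 2).
  by rewrite -(powRB2 p2 a0); field.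
rewrite xE.
have h1 : p ^+ 2 / 2 * a `^ (p - 2) * (a ^+ 2 * x ^+ 2) <=
   p ^+ 2 / 2 * a `^ (p - 2) * (9 * b ^+ 2).
  by rewrite ler_wpM2l// mulr_ge0// divr_ge0// sqr_ge0.
have ab0 : 0 <= a `^ (p - 2) * b ^+ 2 by rewrite mulr_ge0.
have h2 : (9 * p ^+ 2 + p) * (a `^ (p - 2) * b ^+ 2) <=
   C * (a `^ (p - 2) * b ^+ 2 + b `^ p).
  apply: ler_pM => //; first by rewrite addr_ge0// mulr_ge0// sqr_ge0.
    by rewrite /C lerDr addr_ge0 ?mulr_ge0 ?powR_ge0.
  by rewrite lerDl.
have p20 : 0 <= p ^+ 2 by exact: sqr_ge0.
have : 0 <= p ^+ 2 * (a `^ (p - 2) * b ^+ 2) by exact: mulr_ge0.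
have : 0 <= p * (a `^ (p - 2) * b ^+ 2) by exact: mulr_ge0.
clear H; lra.
Qed.

(** Split at [b = h * a] with [h ^+ 2 = eta]: below it [b ^+ 2] is at most [eta * a ^+ 2], above it
    [a] is at most [b / h]. *)
Lemma powRB2_young p eta : 2 <= p -> 0 < eta -> exists2 C, 0 <= C &
  forall a b, 0 <= a -> 0 <= b ->
  a `^ (p - 2) * b ^+ 2 <= eta * a `^ p + C * b `^ p.
Proof.
move=> p2 eta0; pose h := Num.sqrt eta.
have h0 : 0 < h by rewrite sqrtr_gt0.
exists (h^-1 `^ (p - 2)); first exact: powR_ge0.
move=> a b a0 b0; have [ba|ab] := leP b (h * a).
  rewrite ler_wpDr ?mulr_ge0 ?powR_ge0// -(powRB2 p2 a0) [leRHS]mulrCA ler_wpM2l//.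
    exact: powR_ge0.
  have -> : eta * a ^+ 2 = (h * a) ^+ 2 by rewrite exprMn sqr_sqrtr// ltW.
  by rewrite ler_sqr// nnegrE// mulr_ge0// ltW.
rewrite ler_wpDl ?mulr_ge0 ?powR_ge0 ?(ltW eta0)// -(powRB2 p2 b0) [leRHS]mulrA.
rewrite ler_wpM2r ?sqr_ge0// -powRM ?invr_ge0 ?(ltW h0)//.
rewrite ge0_ler_powR ?nnegrE ?mulr_ge0 ?invr_ge0 ?(ltW h0)//; first by lra.
by rewrite mulrC ler_pdivlMr// mulrC ltW.
Qed.

(** The point is the factor [g]: apart from the linear term in [s], which will have mean zero, noise
    of length [Num.sqrt g * v * b] costs only order [g], the same order as the contraction of the
    drift. *)
Lemma powR_scaled_noise_le p eta : 2 <= p -> 0 < eta -> exists2 K, 0 <= K &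
  forall a b n s g v, 0 <= a -> 0 <= b -> 0 <= n -> `|s| <= a * b ->
    0 <= g <= 1 -> 0 <= v ->
    n ^+ 2 = a ^+ 2 + 2 * (Num.sqrt g * v * s) + (Num.sqrt g * v * b) ^+ 2 ->
  n `^ p <= (1 + g * eta) * a `^ p + g * K * v `^ p * b `^ p
            + p * (Num.sqrt g * v) * (a `^ (p - 2) * s).
Proof.
move=> p2 eta0; have [C C0 taylor] := powR_norm_sqrD_le p2.
(* Dividing by [C + 1] offsets the constant [C] of the expansion; the 1 guards against [C = 0]. *)
have e0 : 0 < eta / (C + 1) by rewrite divr_gt0// ltr_wpDl.
have [C2 C20 young] := powRB2_young p2 e0.
exists (C * (C2 + 1)); first by rewrite mulr_ge0// addr_ge0.
move=> a b n s g v a0 b0 n0 sab /andP[g0 g1] v0 nE.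
have [c cE c0] : exists2 c, c = Num.sqrt g * v & 0 <= c.
  by exists (Num.sqrt g * v); rewrite // mulr_ge0// sqrtr_ge0.
rewrite -cE in nE *.
have csab : `|c * s| <= a * (c * b).
  by rewrite normrM (ger0_norm c0) [leRHS]mulrCA ler_wpM2l.
apply: (le_trans (taylor a (c * b) n (c * s) a0 (mulr_ge0 c0 b0) n0 csab nE)).
have cb2 : (c * b) ^+ 2 = g * (v * b) ^+ 2.
  by rewrite -[in RHS](sqr_sqrtr g0) cE; ring.
have vb0 : 0 <= v * b by exact: mulr_ge0.
have := young a (v * b) a0 vb0; rewrite powRM// => y.
(* Here [Num.sqrt g]^ p = g [^ (p / 2)] is at most [g] because [g <= 1] and [2 <= p]. *)
have cbp : (c * b) `^ p <= g * (v `^ p * b `^ p).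
  rewrite cE -mulrA !powRM ?sqrtr_ge0// ler_wpM2r ?mulr_ge0 ?powR_ge0//.
  rewrite -powR12_sqrt// -powRrM.
  have p0 : 0 < p by rewrite (lt_le_trans _ p2).
  have [->|gn0] := eqVneq g 0.
    by rewrite powR0// gt_eqF// mulr_gt0 ?invr_gt0.
  rewrite -[leRHS]powRr1// ger_powR ?g1 ?andbT ?lt_def ?gn0//.
  by rewrite mulrC ler_pdivlMr// mul1r.
rewrite (_ : p * (a `^ (p - 2) * (c * s)) = p * c * (a `^ (p - 2) * s)); last by ring.
rewrite cb2 addrAC lerD2r mulrDl mul1r -addrA lerD2l.
apply: (@le_trans _ _ (C * (g * (eta / (C + 1) * a `^ p + C2 * (v `^ p * b `^ p))
        + g * (v `^ p * b `^ p)))).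
  by rewrite ler_wpM2l// lerD// mulrCA ler_wpM2l.
have h2 : C / (C + 1) * (g * eta * a `^ p) <= g * eta * a `^ p.
  rewrite ler_piMl ?mulr_ge0 ?powR_ge0 ?(ltW eta0)//.
  by rewrite ler_pdivrMr ?ltr_wpDl// mul1r lerDl.
rewrite [leLHS](_ : _ = C / (C + 1) * (g * eta * a `^ p)
  + g * (C * (C2 + 1)) * v `^ p * b `^ p); last by ring.
by rewrite lerD2r.
Qed.

(** Serves as the domination that makes the first-order term of the expansion integrable. *)
Lemma powRB2_mul_le p a b : 2 <= p -> 0 <= a -> 0 <= b ->
  a `^ (p - 2) * (a * b) <= a `^ p + b `^ p.
Proof.
move=> p2 a0 b0; have [ab|ba] := leP a b.
  rewrite ler_wpDl ?powR_ge0// -(powRB2 p2 b0); apply: ler_pM.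
  - exact: powR_ge0.
  - exact: mulr_ge0.
  - by rewrite ge0_ler_powR ?nnegrE//; lra.
  - by rewrite expr2 ler_wpM2r.
rewrite ler_wpDr ?powR_ge0// -(powRB2 p2 a0) ler_wpM2l ?powR_ge0//.
by rewrite expr2 ler_wpM2l// ltW.
Qed.

Lemma powR_convex p t x y : 1 <= p -> 0 <= t <= 1 -> 0 <= x -> 0 <= y ->
  ((1 - t) * x + t * y) `^ p <= (1 - t) * x `^ p + t * y `^ p.
Proof.
move=> p1 /andP[t0 t1] x0 y0.
have s0 : 0 <= 1 - t by lra.
have s1 : 1 - t <= 1 by lra.
have mem z : 0 <= z -> z \in (`[0, +oo[%classic : set R).
  by move=> z0; rewrite inE/= in_itv/= andbT.
have tE : 1 - (1 - t) = t by rewrite subKr.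
rewrite -{2 4}tE; exact: (convex_powR p1 (Itv01 s0 s1) (mem x x0) (mem y y0)).
Qed.

Lemma powRD_le p x y : 0 <= p -> 0 <= x -> 0 <= y ->
  (x + y) `^ p <= 2 `^ p * (x `^ p + y `^ p).
Proof.
move=> p0 x0 y0; have [px py] := (powR_ge0 x p, powR_ge0 y p).
have key m : 0 <= m -> x <= m -> y <= m -> (x + y) `^ p <= 2 `^ p * m `^ p.
  move=> m0 xm ym; rewrite -powRM//.
  by rewrite ge0_ler_powR ?nnegrE ?addr_ge0 ?mulr_ge0// mulr2n mulrDl mul1r lerD.
have [xy|/ltW yx] := leP x y.
  by apply: (le_trans (key _ y0 xy (lexx y))); rewrite ler_wpM2l ?powR_ge0// lerDr.
by apply: (le_trans (key _ x0 (lexx x) yx)); rewrite ler_wpM2l ?powR_ge0// lerDl.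
Qed.

End power_inequalities.

(** * Scalar products on row vectors, their norms and measurability *)

Section scalar_product.
Context {R : realType} {d : nat}.
Variable ip : {dot 'rV[R]_d for idfun}.
Implicit Types (u v : 'rV[R]_d) (a : R).

Lemma ipC u v : ip u v = ip v u.
Proof. by rewrite hermC expr0 mul1r. Qed.

Lemma ip_ge0 u : 0 <= ip u u.
Proof.
have [->|/neq0_dnorm_gt0 /ltW//] := eqVneq u 0.
by rewrite linear0.
Qed.

Lemma ipnorm_ge0 u : 0 <= ipnorm ip u.
Proof. exact: sqrtr_ge0. Qed.

Lemma sqr_ipnorm u : ipnorm ip u ^+ 2 = ip u u.
Proof. by rewrite sqr_sqrtr// ip_ge0. Qed.

Lemma ipZl a u v : ip (a *: u) v = a * ip u v.
Proof. by rewrite linearZl_LR. Qed.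

Lemma ipZr a u v : ip u (a *: v) = a * ip u v.
Proof. by rewrite linearZr. Qed.

Lemma ipnormZ a u : ipnorm ip (a *: u) = `|a| * ipnorm ip u.
Proof. by rewrite /ipnorm ipZl ipZr mulrA -expr2 sqrtrM ?sqr_ge0// sqrtr_sqr. Qed.

Lemma sqr_ipnormD u v :
  ipnorm ip (u + v) ^+ 2 = ipnorm ip u ^+ 2 + 2 * ip u v + ipnorm ip v ^+ 2.
Proof. by rewrite !sqr_ipnorm linearDl/= !linearDr/= (ipC v u); ring. Qed.

Lemma ip_CauchySchwarz u v : `|ip u v| <= ipnorm ip u * ipnorm ip v.
Proof.
have [->|v0] := eqVneq v 0.
  by rewrite linear0 normr0 mulr_ge0// ipnorm_ge0.
have vv : 0 < ip v v by exact: neq0_dnorm_gt0.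
rewrite -(@ler_pXn2r _ 2)// ?nnegrE ?mulr_ge0 ?ipnorm_ge0//.
rewrite real_normK ?num_real// exprMn !sqr_ipnorm.
(* This is the component of [u] orthogonal to [v], multiplied by [ip v v] to avoid a division. *)
have := ip_ge0 (ip v v *: u + (- ip u v) *: v).
rewrite -sqr_ipnorm sqr_ipnormD !sqr_ipnorm !(ipZl, ipZr) => h.
have {h} : 0 <= ip v v * (ip v v * ip u u - ip u v ^+ 2) by nra.
by rewrite pmulr_rge0// subr_ge0 mulrC.
Qed.

Lemma ipnormD u v : ipnorm ip (u + v) <= ipnorm ip u + ipnorm ip v.
Proof.
rewrite -(@ler_pXn2r _ 2)// ?nnegrE ?addr_ge0 ?ipnorm_ge0//.
rewrite sqr_ipnormD; have := ip_CauchySchwarz u v.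
by rewrite ler_norml => /andP[_ h]; nra.
Qed.

Lemma ip_coordr u v : ip u v = \sum_j v ord0 j * ip u (delta_mx ord0 j).
Proof.
by rewrite {1}(row_sum_delta v) linear_sum/=; apply: eq_bigr => j _; rewrite ipZr.
Qed.

(* Coordinates are recovered from scalar products by inverting the Gram matrix. *)
Lemma coord_le_ipnorm : exists2 C, 0 <= C &
  forall u i, `|u ord0 i| <= C * ipnorm ip u.
Proof.
pose G := \matrix_(i, j) ip (delta_mx ord0 i) (delta_mx ord0 j).
have GE u j : (u *m G) ord0 j = ip u (delta_mx ord0 j).
  rewrite mxE ipC ip_coordr; apply: eq_bigr => i _.
  by rewrite mxE ipC.
have Gu : G \in unitmx.
  (* A row killed by [G] is orthogonal to every basis vector, hence to itself, so it vanishes. *)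
  rewrite -row_free_unit -kermx_eq0; apply/rowV0P => u /sub_kermxP uG.
  apply: contraTeq isT => /(@neq0_dnorm_gt0 _ _ _ ip); rewrite ip_coordr big1 ?ltxx//.
  by move=> j _; rewrite -GE uG mxE mulr0.
pose c i := \sum_j ipnorm ip (delta_mx ord0 j) * `|invmx G j i|.
have c0 i : 0 <= c i by apply: sumr_ge0 => j _; rewrite mulr_ge0 ?ipnorm_ge0.
exists (\sum_i c i); first exact: sumr_ge0.
move=> u i; apply: (@le_trans _ _ (c i * ipnorm ip u)).
  rewrite -{1}(mulmxK Gu u) mxE (le_trans (ler_norm_sum _ _ _))//.
  rewrite mulr_suml; apply: ler_sum => j _.
  rewrite GE normrM mulrAC ler_wpM2r// mulrC.
  exact: ip_CauchySchwarz.
by rewrite ler_wpM2r ?ipnorm_ge0// (bigD1 i)//= lerDl sumr_ge0.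
Qed.

Context {disp : measure_display} {T : measurableType disp}.
Implicit Types X Y : T -> 'rV[R]_d.

Lemma measurable_ip X Y :
  (forall i, measurable_fun setT (fun w => X w ord0 i)) ->
  (forall i, measurable_fun setT (fun w => Y w ord0 i)) ->
  measurable_fun setT (fun w => ip (X w) (Y w)).
Proof.
move=> mX mY.
have -> : (fun w => ip (X w) (Y w)) = (fun w => \sum_j \sum_i
    Y w ord0 j * (X w ord0 i * ip (delta_mx ord0 j) (delta_mx ord0 i))).
  apply/funext => w; rewrite ip_coordr; apply: eq_bigr => j _.
  by rewrite ipC ip_coordr mulr_sumr.
apply: measurable_sum => j; apply: measurable_sum => i.
by do ![apply: measurable_funM => //].
Qed.

Lemma measurable_ipnorm X :
  (forall i, measurable_fun setT (fun w => X w ord0 i)) ->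
  measurable_fun setT (fun w => ipnorm ip (X w)).
Proof.
move=> mX; rewrite /ipnorm.
apply: (measurableT_comp (f := @Num.sqrt R) _ (measurable_ip mX mX)).
by apply: continuous_measurable_fun; exact: sqrt_continuous.
Qed.

End scalar_product.

(** * Orthogonality of conditionally centred variables to [G]-measurable factors *)

Section sub_sigma_algebra.
Context {disp : measure_display} {T : measurableType disp} {R : realType}.
Variables (G : set (set T)).
Hypothesis sG : sigma_algebra [set: T] G.

(** The set [T] with [G] as its sigma-algebra, so that [G]-measurability of a function becomes
    ordinary measurability on [TG]. *)
Let TG := g_sigma_algebraType G.

Lemma g_sigma_measurableE (A : set T) :
  measurable (A : set TG) = G A.
Proof.
by rewrite -[in RHS](measurable_g_measurableTypeE sG).
Qed.

Lemma measurable_wrt_coord d (X : T -> 'rV[R]_d) (i : 'I_d) :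
  measurable_wrt G X -> measurable_fun [set: TG] (fun w => X w ord0 i).
Proof.
move=> mX; apply: (measurability _ (RGenOpens.measurableE R)).
move=> _ [_ [x [y ->]] <-]; rewrite setTI.
rewrite g_sigma_measurableE.
apply: (mX [set v | v ord0 i \in `]x, y[]); apply: sub_sigma_algebra.
apply: (@open_comp _ _ (fun v : 'rV[R]_d => v ord0 i) `]x, y[%classic).
  by move=> v _; exact: coord_continuous.
exact: interval_open.
Qed.

Hypothesis Gm : G `<=` measurable.

Lemma g_sigma_measurable_fun d' (U : measurableType d') (g : T -> U) :
  measurable_fun [set: TG] g -> measurable_fun [set: T] g.
Proof.
move=> mg _ B mB; apply: Gm.
by rewrite -g_sigma_measurableE; exact: mg.
Qed.

Variables (P : probability T R) (X : T -> R).
Hypothesis intX : P.-integrable [set: T] (EFin \o X).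
Hypothesis X0 : forall A, G A -> (\int[P]_(w in A) (X w)%:E = 0)%E.

Import HBNNSimple.

(** The level sets of [h] lie in [G], and [X] integrates to zero over each of them. *)
Let integral_nnsfun_mul (h : {nnsfun TG >-> R}) :
  (\int[P]_w (h w * X w)%:E = 0)%E.
Proof.
have mA y : G (h @^-1` [set y]).
  rewrite -g_sigma_measurableE -[X in measurable X]setTI.
  exact: (measurable_funP h).
under eq_integral do rewrite (fimfunEord h) mulr_suml -sumEFin.
have E y w : (y * \1_(h @^-1` [set y]) w * X w)%:E =
    (y%:E * ((EFin \o X) \_ (h @^-1` [set y])) w)%E.
  rewrite patchE /= indicE; case: (w \in _); first by rewrite mulr1 EFinM.
  by rewrite mulr0 mul0r mule0.
have intr y : P.-integrable [set: T] ((EFin \o X) \_ (h @^-1` [set y])).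
  apply/(integrable_mkcond _ (Gm (mA y))).
  by apply: integrableS intX => //; exact: (Gm (mA y)).
rewrite integral_sum//; last first.
  move=> i; apply: eq_integrable (integrableZl measurableT _ (intr _)) => //.
rewrite big1// => i _; under eq_integral do rewrite E.
rewrite integralZl// -integral_mkcond X0 ?mule0//.
Qed.

(** Simple functions increase to [Y], and their products with [X] are dominated by [|Y * X|]. *)
Let ge0_integral_mul (Y : T -> R) : (forall w, 0 <= Y w) ->
  measurable_fun [set: TG] Y ->
  P.-integrable [set: T] (fun w => (Y w * X w)%:E) ->
  (\int[P]_w (Y w * X w)%:E = 0)%E.
Proof.
move=> Y0 mY intYX.
have mEY : measurable_fun [set: TG] (EFin \o Y) by exact/measurable_EFinP.
pose h n := nnsfun_approx measurableT mEY n.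
have mX : measurable_fun [set: T] X by apply/measurable_EFinP; case/integrableP: intX.
have [|||||_ _] := @dominated_convergence _ _ _ P setT measurableT
  (fun n w => (h n w * X w)%:E) (fun w => (Y w * X w)%:E)
  (fun w => `|(Y w * X w)%:E|%E).
- move=> n; apply/measurable_EFinP; apply: measurable_funM => //.
  by apply: g_sigma_measurable_fun; exact: measurable_funP.
- by case/integrableP: intYX.
- apply: nearW => w _; rewrite EFinM.
  under eq_fun do rewrite EFinM.
  apply: cvgeZr => //; apply: cvg_nnsfun_approx => // w' _.
  by rewrite lee_fin.
- exact: integrable_abse.
- apply: nearW => w n _ /=; rewrite lee_fin !normrM ler_wpM2r//.
  rewrite (ger0_norm (Y0 w)) ger0_norm// -lee_fin /h nnsfun_approxE.
  by apply: le_approx => // w' _; rewrite lee_fin.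
have -> : [sequence (\int[P]_w (h n w * X w)%:E)%E]_n = cst 0%E.
  by apply/funext => n /=; exact: integral_nnsfun_mul.
move=> H; apply/esym; apply: (@cvg_unique _ (@ereal_hausdorff R) (cst 0%E @ \oo)) => //.
exact: cvg_cst.
Qed.

(** The positive and negative parts of [Y] are bounded by [|Y|], so their products with [X] inherit
    integrability and the nonnegative case applies to each. *)
Lemma integral_mul_orthogonal (Y : T -> R) :
  measurable_fun [set: TG] Y ->
  P.-integrable [set: T] (fun w => (Y w * X w)%:E) ->
  (\int[P]_w (Y w * X w)%:E = 0)%E.
Proof.
move=> mY intYX.
have mX : measurable_fun [set: T] X by apply/measurable_EFinP; case/integrableP: intX.
have part (Z : T -> R) : measurable_fun [set: TG] Z -> (forall w, 0 <= Z w <= `|Y w|) ->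
   P.-integrable [set: T] (fun w => (Z w * X w)%:E) /\
   (\int[P]_w (Z w * X w)%:E = 0)%E.
  move=> mZ ZY.
  have intZX : P.-integrable [set: T] (fun w => (Z w * X w)%:E).
    apply: le_integrable intYX => //.
      apply/measurable_EFinP; apply: measurable_funM => //.
      exact: g_sigma_measurable_fun.
    move=> w _ /=; have /andP[Z0 ?] := ZY w.
    by rewrite lee_fin !normrM ler_wpM2r// ger0_norm.
  by split=> //; apply: ge0_integral_mul => // w; case/andP: (ZY w).
have [||i1 e1] := part (Y ^\+)%R.
- exact: measurable_funrpos.
- by move=> w; rewrite /funrpos ge_max le_max normr_ge0 ler_norm lexx orbT.
have [||i2 e2] := part (Y ^\-)%R.
- exact: measurable_funrneg.
- by move=> w; rewrite /funrneg ge_max le_max normr_ge0 lexx orbT -normrN ler_norm.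
have -> : (fun w => (Y w * X w)%:E) =
   ((fun w => (Y^\+ w * X w)%:E) \- (fun w => (Y^\- w * X w)%:E))%E.
  apply/funext => w /=; rewrite -EFinB -mulrBl; congr (_ * _)%:E.
  by rewrite -[in LHS](funrposBneg Y).
by rewrite integralB// e1 e2 sube0.
Qed.

End sub_sigma_algebra.

(** * Eventual and uniform real bounds from extended-real ones *)

Section limsup_bounds.
Context {R : realType}.
Local Open Scope ereal_scope.

(** The limsup is an infimum of suprema over neighbourhoods of infinity; [b] is one such supremum
    lying below [a]. The strict gap between [b] and [a] is what later leaves room for a slower
    contraction rate. *)
Lemma limn_esup_lt_near (u : nat -> R) (a : \bar R) :
  limn_esup (fun n => (u n)%:E) < a ->
  exists2 b : R, b%:E < a & \forall n \near \oo, (u n <= b)%R.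
Proof.
move=> /ereal_inf_lt[_ [V Voo <-] Va].
have uV n : V n -> (u n)%:E <= ereal_sup [set (u n)%:E | n in V].
  by move=> Vn; apply: ereal_sup_ubound; exists n.
have [n0 Vn0] : exists n, V n.
  by have [N _ VN] := Voo; exists N; apply: VN => /=.
case E : (ereal_sup _) (uV) Va => [b| |] h Va.
- exists b => //; apply: filterS Voo => n Vn; rewrite -lee_fin; exact: h.
- by rewrite ltNge leey in Va.
- by have := h _ Vn0; rewrite leeNy_eq.
Qed.

Lemma lty_le_fin (x : \bar R) : x < +oo -> exists2 c : R, (0 <= c)%R & x <= c%:E.
Proof.
case: x => [r| |]// _; last by exists 0%R; rewrite ?lexx ?leNye.
by exists (Num.max 0 r)%R; rewrite ?lee_fin le_max lexx ?orbT.
Qed.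

End limsup_bounds.

(** * Consequences of condition (a) for one drift step *)

Section dissipativity.
Context {R : realType} {d : nat}.
Variable ip : {dot 'rV[R]_d for idfun}.
Implicit Types (x y : 'rV[R]_d) (g L : R).

(** By Cauchy-Schwarz, [L * |y|^2 <= - <x, y> <= |x| * |y|]. With [y = f theta] this is linear
    growth of the drift. *)
Lemma ipnorm_le_of_cocoercive x y L : 0 < L ->
  ip x y <= - L * ipnorm ip y ^+ 2 -> ipnorm ip y <= L^-1 * ipnorm ip x.
Proof.
move=> L0 h; have [y0|y0] := eqVneq (ipnorm ip y) 0.
  by rewrite y0 mulr_ge0 ?ipnorm_ge0// invr_ge0 ltW.
have {}y0 : 0 < ipnorm ip y by rewrite lt_def y0 ipnorm_ge0.
rewrite mulrC ler_pdivlMr// -(ler_pM2r y0).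
have := ip_CauchySchwarz ip x y; rewrite ler_norml => /andP[h1 _].
rewrite -mulrA mulrCA -expr2; lra.
Qed.

Lemma ipnorm_contraction x y g L L' L1 : 0 < L' -> 0 <= L -> 0 <= g ->
  ip x y <= - L * ipnorm ip x ^+ 2 -> ip x y <= - L' * ipnorm ip y ^+ 2 ->
  g <= L' -> g * L <= 2 * (L - L1) * L' -> g * L1 <= 1 ->
  ipnorm ip (x + g *: y) <= (1 - g * L1) * ipnorm ip x.
Proof.
move=> L'0 L0 g0 h h' gL' gL gL1.
rewrite -(@ler_pXn2r _ 2)// ?nnegrE ?mulr_ge0 ?ipnorm_ge0 ?subr_ge0//.
rewrite sqr_ipnormD ipnormZ ipZr exprMn real_normK ?num_real// exprMn.
have : ipnorm ip y ^+ 2 <= - ip x y / L'.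
  by rewrite ler_pdivlMr//; lra.
set s := ip x y in h h' *; set X := ipnorm ip x ^+ 2 in h *.
have X0 : 0 <= X by exact: sqr_ge0.
move=> /(ler_wpM2l (sqr_ge0 g)) hy.
(* The cross term ends up with coefficient [g * (2 - e)], nonnegative since [e <= 1]; the loss
   [e * L] is absorbed by the gap between [L] and [L1]. *)
have [e eD e1] : exists2 e, e = g / L' & e <= 1.
  by exists (g / L') => //; rewrite ler_pdivrMr// mul1r.
have -> : 2 * (g * s) = g * 2 * s by ring.
have hs : g * (2 - e) * s <= g * (2 - e) * (- L * X).
  by rewrite ler_wpM2l// mulr_ge0//; lra.
have eE : g ^+ 2 * (- s / L') = - g * e * s by rewrite eD; ring.
have eL : e * L <= 2 * (L - L1) by rewrite eD mulrAC ler_pdivrMr.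
have : g * X * (e * L) <= g * X * (2 * (L - L1)) by rewrite ler_wpM2l// mulr_ge0.
have : 0 <= (g * L1) ^+ 2 * X by rewrite mulr_ge0// sqr_ge0.
rewrite eE in hy; lra.
Qed.

End dissipativity.

(** * Moments of order [p] under a martingale-difference perturbation *)

Section moments.
Context {R : realType} {d : nat} {disp : measure_display}
  {T : measurableType disp}.
Variables (ip : {dot 'rV[R]_d for idfun}) (P : probability T R) (p : R).
Hypothesis p2 : 2 <= p.
Implicit Types X Y D : T -> 'rV[R]_d.

Local Notation moment X := (fun w => (ipnorm ip (X w) `^ p)%:E).

Lemma measurable_moment X :
  (forall i, measurable_fun setT (fun w => X w ord0 i)) ->
  measurable_fun setT (moment X).
Proof.
move=> mX; apply/measurable_EFinP.
exact: (measurableT_comp (measurable_powR _) (measurable_ipnorm ip mX)).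
Qed.

Lemma ae_le_integrable (f g : T -> R) : measurable_fun setT f ->
  (forall w, 0 <= f w) -> {ae P, forall w, f w <= g w} ->
  P.-integrable setT (EFin \o g) -> P.-integrable setT (EFin \o f).
Proof.
move=> mf f0 fg intg; apply/integrableP; split; first exact/measurable_EFinP.
have /integrableP[mg] := intg; apply: le_lt_trans.
apply: ae_ge0_le_integral => //.
- by apply: measurableT_comp => //; exact/measurable_EFinP.
- by apply: measurableT_comp.
apply: filterS fg => w fg _ /=; rewrite lee_fin ger0_norm//.
by rewrite (le_trans fg)// ler_norm.
Qed.

Section sub_sigma_algebra_moments.
Variable G : set (set T).
Hypothesis sG : sigma_algebra [set: T] G.
Hypothesis Gm : G `<=` measurable.

Section orthogonality.
Variables (Y D : T -> 'rV[R]_d).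
Hypothesis mY : forall i,
  measurable_fun [set: g_sigma_algebraType G] (fun w => Y w ord0 i).
Hypothesis mD : forall i, measurable_fun [set: T] (fun w => D w ord0 i).
Hypothesis intD : forall i,
  P.-integrable [set: T] (EFin \o (fun w => D w ord0 i)).
Hypothesis D0 : forall i A, G A -> (\int[P]_(w in A) (D w ord0 i)%:E = 0)%E.
Hypothesis momY : P.-integrable [set: T] (moment Y).
Hypothesis momD : P.-integrable [set: T] (moment D).

Let mYT i : measurable_fun [set: T] (fun w => Y w ord0 i).
Proof. exact: (g_sigma_measurable_fun sG Gm (mY i)). Qed.

Let mom_coord j : P.-integrable [set: T] (fun w =>
  (ipnorm ip (Y w) `^ (p - 2) * ip (Y w) (delta_mx ord0 j) * D w ord0 j)%:E).
Proof.
have [C C0 hC] := coord_le_ipnorm ip.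
have [K KE K0] : exists2 K, K = ipnorm ip (delta_mx ord0 j) * C & 0 <= K.
  by exists (ipnorm ip (delta_mx ord0 j) * C); rewrite ?mulr_ge0 ?ipnorm_ge0.
have := integrableZl measurableT K (integrableD measurableT momY momD).
apply: le_integrable => //.
  apply/measurable_EFinP; apply: measurable_funM => //.
  apply: measurable_funM; last exact: measurable_ip.
  exact: (measurableT_comp (measurable_powR _) (measurable_ipnorm ip mYT)).
move=> w _ /=; rewrite lee_fin !normrM (ger0_norm (powR_ge0 _ _)).
rewrite (ger0_norm K0) [`|_ + _|]ger0_norm ?addr_ge0 ?powR_ge0//.
set a := ipnorm ip (Y w); set b := ipnorm ip (D w).
have a0 : 0 <= a by exact: ipnorm_ge0.
have b0 : 0 <= b by exact: ipnorm_ge0.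
apply: (@le_trans _ _ (a `^ (p - 2) * (a * ipnorm ip (delta_mx ord0 j)) * (C * b))).
  apply: ler_pM => //; first by rewrite mulr_ge0 ?powR_ge0.
  by rewrite ler_wpM2l ?powR_ge0//; exact: ip_CauchySchwarz.
rewrite [leLHS](_ : _ = K * (a `^ (p - 2) * (a * b))); last by rewrite KE; ring.
by rewrite ler_wpM2l//; exact: powRB2_mul_le.
Qed.

(** Conditional centring of [D] is known coordinatewise, so the scalar product is split into
    coordinates of [D] with weights depending on [Y] alone. *)
Let sum_coord w : (ipnorm ip (Y w) `^ (p - 2) * ip (Y w) (D w))%:E =
  (\sum_j (ipnorm ip (Y w) `^ (p - 2) * ip (Y w) (delta_mx ord0 j)
     * D w ord0 j)%:E)%E.
Proof.
rewrite sumEFin ip_coordr mulr_sumr; congr EFin.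
by apply: eq_bigr => j _; ring.
Qed.

Lemma integrable_moment_ip : P.-integrable [set: T]
  (fun w => (ipnorm ip (Y w) `^ (p - 2) * ip (Y w) (D w))%:E).
Proof.
under eq_fun do rewrite sum_coord.
by apply: integrable_sum => // j; exact: mom_coord.
Qed.

Lemma integral_moment_ip :
  (\int[P]_w (ipnorm ip (Y w) `^ (p - 2) * ip (Y w) (D w))%:E = 0)%E.
Proof.
under eq_integral do rewrite sum_coord.
rewrite integral_sum// big1// => j _.
apply: (integral_mul_orthogonal sG Gm (intD j) (D0 j)) => //.
apply: measurable_funM.
  exact: (measurableT_comp (measurable_powR _) (measurable_ipnorm ip mY)).
exact: measurable_ip.
Qed.

End orthogonality.

End sub_sigma_algebra_moments.

(** Integrates [powR_scaled_noise_le]. [K] is fixed before [G], [Y], [D], [g] and [v], so a single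
    constant serves all time steps. *)
Lemma moment_martingale_step (eta : R) : 0 < eta -> exists2 K, 0 <= K &
  forall (G : set (set T)) Y D (g v : R),
  sigma_algebra [set: T] G -> G `<=` measurable ->
  (forall i, measurable_fun [set: g_sigma_algebraType G] (fun w => Y w ord0 i)) ->
  (forall i, measurable_fun [set: T] (fun w => D w ord0 i)) ->
  (forall i, P.-integrable [set: T] (EFin \o (fun w => D w ord0 i))) ->
  (forall i A, G A -> (\int[P]_(w in A) (D w ord0 i)%:E = 0)%E) ->
  P.-integrable [set: T] (moment Y) -> P.-integrable [set: T] (moment D) ->
  0 <= g <= 1 -> 0 <= v ->
  (\int[P]_w (ipnorm ip (Y w + (Num.sqrt g * v) *: D w) `^ p)%:E <=
   (1 + g * eta)%:E * \int[P]_w (ipnorm ip (Y w) `^ p)%:E +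
   (g * K * v `^ p)%:E * \int[P]_w (ipnorm ip (D w) `^ p)%:E)%E.
Proof.
move=> eta0; have [K0 K00 noise] := powR_scaled_noise_le p2 eta0.
exists K0 => // G Y D g v sG Gm mY mD intD D0 momY momD g01 v0.
set c := Num.sqrt g * v.
have c0 : 0 <= c by rewrite mulr_ge0// sqrtr_ge0.
set K := g * K0 * v `^ p.
have mYT i : measurable_fun [set: T] (fun w => Y w ord0 i).
  exact: (g_sigma_measurable_fun sG Gm (mY i)).
have intM := integrable_moment_ip sG Gm mY mD momY momD.
(* [B] is the pointwise majorant; its last summand integrates to zero by orthogonality. *)
pose B w := ((1 + g * eta)%:E * (ipnorm ip (Y w) `^ p)%:E +
   K%:E * (ipnorm ip (D w) `^ p)%:E +
  (p * c)%:E * (ipnorm ip (Y w) `^ (p - 2) * ip (Y w) (D w))%:E)%E.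
have int1 := integrableZl measurableT (1 + g * eta) momY.
have int2 := integrableZl measurableT K momD.
have int3 := integrableZl measurableT (p * c) intM.
have int12 := integrableD measurableT int1 int2.
have intB : P.-integrable [set: T] B := integrableD measurableT int12 int3.
have pw w : ((ipnorm ip (Y w + c *: D w) `^ p)%:E <= B w)%E.
  rewrite /B -!EFinM -!EFinD lee_fin.
  apply: noise => //; rewrite ?ipnorm_ge0 ?ip_CauchySchwarz//.
  by rewrite sqr_ipnormD ipZr ipnormZ (ger0_norm c0).
have -> : ((1 + g * eta)%:E * \int[P]_w (ipnorm ip (Y w) `^ p)%:E +
   K%:E * \int[P]_w (ipnorm ip (D w) `^ p)%:E)%E = (\int[P]_w B w)%E.
  rewrite (integralD measurableT int12 int3) (integralD measurableT int1 int2).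
  rewrite !integralZl//.
  by rewrite (integral_moment_ip sG Gm mY mD intD D0 momY momD) mule0 adde0.
apply: ge0_le_integral => //.
- by move=> w _; rewrite lee_fin powR_ge0.
- apply: measurable_moment => i.
  under eq_fun do rewrite !mxE.
  by apply: measurable_funD => //; apply: measurable_funM.
- by have /integrableP[] := intB.
Qed.

End moments.

(** * Deterministic recursion for the normalised moments *)

Section recursion.
Context {R : realType}.
Implicit Types p g C x a v : R.

Lemma drift_powR p g C x a v (L1 L2 : R) : 1 <= p -> 0 <= g -> 0 <= C -> 0 <= x ->
  0 <= a -> 0 <= v -> 0 <= L2 -> L2 < L1 -> 2 * (g * L2) <= 1 ->
  g * (L1 - L2) <= 1 -> a <= (1 - g * L1) * x + g * (C * v) ->
  a `^ p <= (1 - g * L2) `^ p * ((1 - g * (L1 - L2)) * x `^ p +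
     g * (L1 - L2) * (2 * C / (L1 - L2) * v) `^ p).
Proof.
move=> p1 g0 C0 x0 a0 v0 L20 L21 gL2 gd ha.
have [dl [dE d0]] : exists dl, dl = L1 - L2 /\ 0 < dl.
  by exists (L1 - L2); rewrite subr_gt0.
rewrite -dE in gd *.
have [y yE y0] : exists2 y, y = 2 * C / dl * v & 0 <= y.
  by exists (2 * C / dl * v); rewrite // !mulr_ge0// invr_ge0 ltW.
rewrite -yE.
have t01 : 0 <= g * dl <= 1 by rewrite gd mulr_ge0// ltW.
have s0 : 0 <= 1 - g * L2 by lra.
have z0 : 0 <= (1 - g * dl) * x + g * dl * y.
  by have dl0 := ltW d0; rewrite addr_ge0 ?mulr_ge0 ?subr_ge0.
apply: (@le_trans _ _ (((1 - g * L2) * ((1 - g * dl) * x + g * dl * y)) `^ p)).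
  rewrite ge0_ler_powR ?nnegrE ?mulr_ge0//; first by lra.
  apply: (le_trans ha).
  have e : g * dl * y = 2 * (g * (C * v)).
    by rewrite yE; field; rewrite gt_eqF.
  have h1 : 0 <= (1 - 2 * (g * L2)) * (g * (C * v)).
    by rewrite mulr_ge0 ?subr_ge0// !mulr_ge0.
  have h2 : 0 <= (g * L2) * (g * dl) * x by rewrite !mulr_ge0// ltW.
  have -> : L1 = L2 + dl by lra.
  by rewrite e; lra.
rewrite powRM// ler_wpM2l ?powR_ge0//.
exact: powR_convex.
Qed.

(** Read [m], [y], [m'] as the moments of [X_n], [Y_n], [X_{n+1}], and [V], [V'] as [v_n^p],
    [v_{n+1}^p]. With [t = g * dl], [(1 + t / 2) * (1 - t) <= 1 - t / 2] leaves a surplus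
    [t / 2 * K * V'], which pays for the [A] and [B] terms when [K] is large. *)
Lemma moment_recursion_step (g dl A B K r m m' y V V' : R) :
  0 <= g -> 0 <= dl -> g * dl <= 1 -> 0 <= A -> 0 <= B -> 0 <= K ->
  0 <= r <= 1 -> 0 <= V' -> r * V <= V' ->
  2 * (2 * dl * A + B) <= dl * K ->
  y <= r * ((1 - g * dl) * m + g * dl * (A * V')) ->
  m' <= (1 + g * (dl / 2)) * y + g * B * V' ->
  m <= K * V -> m' <= K * V'.
Proof.
move=> g0 dl0 gd A0 B0 K0 /andP[r0 r1] V0 rV hK hy hm mK.
set t := g * dl in gd hy *.
have t0 : 0 <= t by exact: mulr_ge0.
have y1 : y <= ((1 - t) * K + t * A) * V'.
  apply: (le_trans hy).
  have h1 : (1 - t) * (r * m) <= (1 - t) * (K * V').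
    rewrite ler_wpM2l ?subr_ge0//.
    apply: (@le_trans _ _ (r * (K * V))); first by rewrite ler_wpM2l.
    by rewrite mulrCA ler_wpM2l.
  have h2 : r * (t * (A * V')) <= 1 * (t * (A * V')).
    by rewrite ler_wpM2r// !mulr_ge0.
  by lra.
have h3 : (1 + t / 2) * y <= (1 + t / 2) * (((1 - t) * K + t * A) * V').
  by rewrite ler_wpM2l//; lra.
have h4 : 0 <= (1 - t) * (t * A * V') by rewrite !mulr_ge0// subr_ge0.
have h5 : 0 <= t * t * K * V' by rewrite !mulr_ge0.
have h6 : 0 <= t * A * V' by rewrite !mulr_ge0.
have h7 : g * V' * (2 * (2 * dl * A + B)) <= g * V' * (dl * K).
  by rewrite ler_wpM2l// mulr_ge0.
have h8 : g * V' * (2 * (2 * dl * A + B)) = 4 * (t * A * V') + 2 * (g * B * V').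
  by rewrite /t; ring.
have h9 : g * V' * (dl * K) = t * K * V' by rewrite /t; ring.
have h10 : (1 + g * (dl / 2)) * y = (1 + t / 2) * y by rewrite /t mulrA.
rewrite h8 h9 in h7; rewrite h10 in hm.
by clearbody t; clear -hm h3 h4 h5 h6 h7; lra.
Qed.

End recursion.

(** * Uniform control of the [p]-th moments relative to the noise scale *)

Theorem theorem2p4 (R : realType) (p : R) (hp : 2 <= p)
  (disp : measure_display) (T : measurableType disp) (P : probability T R)
  (F : nat -> set (set T)) (hF : filtration F)
  (d : nat) (hd : (0 < d)%N) (ip : {dot 'rV[R]_d for idfun})
  (f : 'rV[R]_d -> 'rV[R]_d) (hf : measurable_wrt (@borel_rV R d) f)
  (thetastar : 'rV[R]_d) (hzero : forall x : 'rV[R]_d, f x = 0 <-> x = thetastar)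
  (gamma epsilon sigma : nat -> R)
  (hgamma : forall n, (0 < n)%N -> 0 < gamma n)
  (hgamma0 : gamma @ \oo --> (0 : R))
  (hepsilon : forall n, (0 < n)%N -> 0 <= epsilon n)
  (hsigma : forall n, (0 < n)%N -> 0 <= sigma n)
  (Rm D : nat -> T -> 'rV[R]_d)
  (hRm : previsible F Rm) (hD : martingale_differences P F D)
  (theta0 : 'rV[R]_d) (theta : nat -> T -> 'rV[R]_d)
  (htheta_adapted : adapted F theta)
  (htheta0 : forall w, theta 0%N w = theta0)
  (htheta : forall n w, theta n.+1 w = theta n w + gamma n.+1 *:
     (f (theta n w) + epsilon n.+1 *: Rm n.+1 w + sigma n.+1 *: D n.+1 w))
  (L L' : R) (hL : 0 < L) (hL' : 0 < L')
  (ha : forall x : 'rV[R]_d, ip (x - thetastar) (f x) <=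
     - L * ipnorm ip (x - thetastar) ^+ 2)
  (ha' : forall x : 'rV[R]_d, ip (x - thetastar) (f x) <= - L' * ipnorm ip (f x) ^+ 2)
  (hb : (ereal_sup [set ess_sup P (fun w => (ipnorm ip (Rm n w))%:E)
     | n in [set n | (0 < n)%N]] < +oo)%E)
  (hb' : (ereal_sup [set 'E_P[fun w => (ipnorm ip (D n w) `^ p)%R]
     | n in [set n | (0 < n)%N]] < +oo)%E)
  (hc : forall n, (0 < n)%N -> 0 < noise_scale gamma sigma n)
  (hc' : (limn_esup
     (fun n => (epsilon n / noise_scale gamma sigma n)%:E) < +oo)%E)
  (hc'' : (limn_esup (fun n => ((gamma n.+1)^-1 *
     ((noise_scale gamma sigma n - noise_scale gamma sigma n.+1) /
      noise_scale gamma sigma n))%:E) < L%:E)%E) :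
  exists2 kappa : R, 0 < kappa &
    forall n, (0 < n)%N ->
      (('E_P[fun w => (ipnorm ip (theta n w - thetastar) `^ p)%R]) `^ p^-1
        <= (kappa * noise_scale gamma sigma n)%:E)%E.
Proof.
have p1 : 1 <= p by lra.
have p0 : 0 <= p by lra.
have [sF Fm _] := hF.
set v := noise_scale gamma sigma in hc hc' hc'' *.
have v0 n : 0 <= v n.+1 by exact: ltW (hc _ _).
pose X n w := theta n w - thetastar.
(* The noise coefficient [gamma * sigma] equals [Num.sqrt gamma * v], the form required by
   [moment_martingale_step]. *)
have XS n w : X n.+1 w = X n w + gamma n.+1 *: f (theta n w)
    + (gamma n.+1 * epsilon n.+1) *: Rm n.+1 w
    + (Num.sqrt (gamma n.+1) * v n.+1) *: D n.+1 w.
  rewrite /X htheta /v /noise_scale mulrA -expr2 sqr_sqrtr ?(ltW (hgamma _ _))//.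
  by rewrite !scalerDr !scalerA !addrA !(addrAC _ (- thetastar)).
clearbody v.
pose Y n w := X n w + gamma n.+1 *: f (theta n w)
    + (gamma n.+1 * epsilon n.+1) *: Rm n.+1 w.
have coordX n i : measurable_fun [set: g_sigma_algebraType (F n)]
    (fun w => X n w ord0 i).
  under eq_fun do rewrite !mxE.
  apply: measurable_funB => //.
  exact: (measurable_wrt_coord (sF n) i (htheta_adapted n)).
have coordY n i : measurable_fun [set: g_sigma_algebraType (F n)]
    (fun w => Y n w ord0 i).
  have -> : (fun w => Y n w ord0 i) = (fun w => X n w ord0 i
     + gamma n.+1 * f (theta n w) ord0 i
     + (gamma n.+1 * epsilon n.+1) * Rm n.+1 w ord0 i).
    by apply/funext => w; rewrite !mxE.
  have mf : measurable_wrt (F n) (fun w => f (theta n w)).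
    by move=> B /hf; exact: htheta_adapted.
  apply: measurable_funD; first apply: measurable_funD => //.
    apply: measurable_funM => //.
    exact: (measurable_wrt_coord (sF n) i mf).
  apply: measurable_funM => //.
  exact: (measurable_wrt_coord (sF n) i (hRm n)).
have coordD n i : measurable_fun [set: T] (fun w => D n.+1 w ord0 i).
  apply: (g_sigma_measurable_fun (sF n.+1) (Fm n.+1)).
  by apply: measurable_wrt_coord => //; case: (hD n).
have coordXT n i : measurable_fun [set: T] (fun w => X n w ord0 i).
  exact: (g_sigma_measurable_fun (sF n) (Fm n) (coordX n i)).
have coordYT n i : measurable_fun [set: T] (fun w => Y n w ord0 i).
  exact: (g_sigma_measurable_fun (sF n) (Fm n) (coordY n i)).
have intD n i : P.-integrable [set: T] (EFin \o (fun w => D n.+1 w ord0 i)).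
  by have [_ /(_ i)[]] := hD n.
have D0 n i A : F n A -> (\int[P]_(w in A) (D n.+1 w ord0 i)%:E = 0)%E.
  by have [_ /(_ i)[_ _ _ h]] := hD n; move=> /h ->; rewrite integral0.
have integral_const (c : R) : (\int[P]__ c%:E = c%:E)%E.
  rewrite (_ : (fun=> c%:E) = cst c%:E)// integral_cst//.
  by rewrite [X in (_ * X)%E](_ : _ = 1%E) ?mule1//; exact: probability_setT.
have [M M0 hM] : exists2 M : R, 0 <= M & forall n,
    (\int[P]_w (ipnorm ip (D n.+1 w) `^ p)%:E <= M%:E)%E.
  have [M M0 hM] := lty_le_fin hb'; exists M => // n.
  apply: le_trans hM; apply: ereal_sup_ubound; exists n.+1 => //.
  by rewrite unlock.
have [CR CR0 hCR] : exists2 C : R, 0 <= C & forall n,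
    {ae P, forall w, ipnorm ip (Rm n.+1 w) <= C}.
  have [C C0 hC] := lty_le_fin hb; exists C => // n.
  have : (ess_sup P (fun w => (ipnorm ip (Rm n.+1 w))%:E) <= C%:E)%E.
    by apply: le_trans hC; apply: ereal_sup_ubound; exists n.+1.
  by move=> /ess_supP; apply: filterS => w; rewrite lee_fin.
have momD n : P.-integrable [set: T] (fun w => (ipnorm ip (D n.+1 w) `^ p)%:E).
  apply/integrableP; split; first exact: measurable_moment.
  apply: le_lt_trans (ltry M); apply: le_trans (hM n).
  by under eq_integral do rewrite gee0_abs ?lee_fin ?powR_ge0//.
have Ybound n w : ipnorm ip (Rm n.+1 w) <= CR ->
    ipnorm ip (Y n w) <= ipnorm ip (X n w + gamma n.+1 *: f (theta n w))
      + gamma n.+1 * (epsilon n.+1 * CR).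
  move=> hR; apply: (le_trans (ipnormD _ _ _)); rewrite lerD2l ipnormZ.
  have ge0 : 0 <= gamma n.+1 * epsilon n.+1.
    by rewrite mulr_ge0 ?hepsilon// ltW// hgamma.
  by rewrite ger0_norm// mulrA ler_wpM2l.
(* Linear growth of [f] and the almost sure bound on [Rm] carry a finite moment from [X n] to [Y n];
   the next claim carries it on to [X n.+1], starting from the deterministic [theta0]. *)
have momY n : P.-integrable [set: T] (fun w => (ipnorm ip (X n w) `^ p)%:E) ->
    P.-integrable [set: T] (fun w => (ipnorm ip (Y n w) `^ p)%:E).
  move=> momX; have g0 : 0 < gamma n.+1 by exact: hgamma.
  pose c := gamma n.+1 * (epsilon n.+1 * CR).
  have c0 : 0 <= c by rewrite !mulr_ge0 ?hepsilon// ltW.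
  pose g w := 2 `^ p * (((1 + gamma n.+1 * L'^-1) * ipnorm ip (X n w)) `^ p
    + c `^ p).
  apply: (@ae_le_integrable _ _ _ _ _ g).
  - exact/measurable_EFinP/measurable_moment.
  - by move=> w; exact: powR_ge0.
  - apply: filterS (hCR n) => w /Ybound h.
    have k0 : 0 <= 1 + gamma n.+1 * L'^-1.
      by rewrite addr_ge0// mulr_ge0 ?invr_ge0 ?ltW.
    apply: le_trans (powRD_le _ _ _) => //; last first.
      by rewrite mulr_ge0 ?ipnorm_ge0.
    rewrite ge0_ler_powR ?nnegrE ?addr_ge0 ?mulr_ge0 ?ipnorm_ge0 ?hepsilon//.
      exact: ltW.
    apply: (le_trans h); rewrite lerD2r.
    apply: (le_trans (ipnormD _ _ _)); rewrite mulrDl mul1r lerD2l ipnormZ.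
    rewrite gtr0_norm// -mulrA ler_wpM2l ?(ltW g0)//.
    exact: (ipnorm_le_of_cocoercive hL' (ha' _)).
  - have -> : EFin \o g = (fun w => (2 `^ p * (1 + gamma n.+1 * L'^-1) `^ p)%:E *
       (ipnorm ip (X n w) `^ p)%:E + (2 `^ p * c `^ p)%:E)%E.
      apply/funext => w; rewrite /g /= -EFinM -EFinD; congr EFin.
      rewrite powRM ?ipnorm_ge0//; first by ring.
      by rewrite addr_ge0// mulr_ge0 ?invr_ge0 ?ltW.
    apply: integrableD => //; first exact: integrableZl.
    exact: finite_measure_integrable_cst.
have momX n : P.-integrable [set: T] (fun w => (ipnorm ip (X n w) `^ p)%:E).
  elim: n => [|n IH].
    under eq_fun do rewrite /X htheta0.
    exact: finite_measure_integrable_cst.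
  have [c cE c0] : exists2 c, c = Num.sqrt (gamma n.+1) * v n.+1 & 0 <= c.
    by exists (Num.sqrt (gamma n.+1) * v n.+1); rewrite // mulr_ge0 ?sqrtr_ge0.
  pose g w := 2 `^ p * (ipnorm ip (Y n w) `^ p
     + (c * ipnorm ip (D n.+1 w)) `^ p).
  apply: (@ae_le_integrable _ _ _ _ _ g).
  - exact/measurable_EFinP/measurable_moment.
  - by move=> w; exact: powR_ge0.
  - apply: nearW => w.
    apply: le_trans (powRD_le _ _ _) => //; last 2 first.
    + exact: ipnorm_ge0.
    + by rewrite mulr_ge0 ?ipnorm_ge0.
    rewrite ge0_ler_powR ?nnegrE ?addr_ge0 ?mulr_ge0 ?ipnorm_ge0//.
    rewrite XS -cE; apply: (le_trans (ipnormD _ _ _)).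
    by rewrite lerD2l ipnormZ ger0_norm.
  - have -> : EFin \o g = (fun w => (2 `^ p)%:E * (ipnorm ip (Y n w) `^ p)%:E
       + (2 `^ p * c `^ p)%:E * (ipnorm ip (D n.+1 w) `^ p)%:E)%E.
      apply/funext => w; rewrite /g /= -!EFinM -!EFinD; congr EFin.
      by rewrite powRM ?ipnorm_ge0//; ring.
    apply: integrableD => //; apply: integrableZl => //.
    exact: momY.
pose m n := fine (\int[P]_w (ipnorm ip (X n w) `^ p)%:E)%E.
have mE n : (\int[P]_w (ipnorm ip (X n w) `^ p)%:E)%E = (m n)%:E.
  by rewrite fineK// integrable_fin_num.
have m0 n : 0 <= m n.
  by apply: fine_ge0; apply: integral_ge0 => w _; rewrite lee_fin powR_ge0.
have [b bL hbb] := limn_esup_lt_near hc''; rewrite lte_fin in bL.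
have [Ce Ceoo hCe] := limn_esup_lt_near hc'.
(* [v] decays at rate at most [L2] and the drift contracts at rate [L1]; the
   gap [dl] is what absorbs the error terms in the recursion for
   [m n / v n `^ p]. *)
pose L2 := Num.max 0 b.
have L20 : 0 <= L2 by rewrite le_max lexx.
have L2L : L2 < L by rewrite gt_max hL.
pose L1 := (L + L2) / 2.
have L12 : L2 < L1 by rewrite /L1; lra.
have L1L : L1 < L by rewrite /L1; lra.
pose dl := L1 - L2.
have dl0 : 0 < dl by rewrite subr_gt0.
(* Taking [eta = dl / 2] spends half of the contraction gap on the second-order noise term. *)
have [K2 K20 mstep] : exists2 K, 0 <= K & forall n, gamma n.+1 <= 1 ->
    (\int[P]_w (ipnorm ip (X n.+1 w) `^ p)%:E <=
     (1 + gamma n.+1 * (dl / 2))%:E * \int[P]_w (ipnorm ip (Y n w) `^ p)%:E +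
     (gamma n.+1 * K * v n.+1 `^ p)%:E *
     \int[P]_w (ipnorm ip (D n.+1 w) `^ p)%:E)%E.
  have e0 : 0 < dl / 2 by rewrite divr_gt0.
  have [K K0 hK] := moment_martingale_step ip P hp e0; exists K => // n g1.
  under eq_integral do rewrite XS.
  apply: (hK (F n) (Y n) (D n.+1)) => //.
  - exact: D0.
  - exact: momY.
  - by rewrite g1 ltW// hgamma.
(* Eventually [epsilon * |Rm| <= C * v] almost surely; the maximum makes the constant nonnegative.
   [A] below is the [p]-th power of the factor of [v] in [drift_powR]. *)
pose C := Num.max 0 Ce * CR.
have C0 : 0 <= C by rewrite mulr_ge0// le_max lexx.
pose A := (2 * C / dl) `^ p.
have A0 : 0 <= A by exact: powR_ge0.
have ystep n : gamma n.+1 <= L' -> gamma n.+1 * L <= 2 * (L - L1) * L' ->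
    2 * (gamma n.+1 * L) <= 1 -> epsilon n.+1 <= Ce * v n.+1 ->
    (\int[P]_w (ipnorm ip (Y n w) `^ p)%:E <=
     ((1 - gamma n.+1 * L2) `^ p * ((1 - gamma n.+1 * dl) * m n +
        gamma n.+1 * dl * (A * v n.+1 `^ p)))%:E)%E.
  move=> gL' gLL gL he; set g := gamma n.+1 in gL' gLL gL *.
  have g0 : 0 < g by exact: hgamma.
  have gL2 : g * L2 <= g * L by rewrite ler_pM2l// ltW.
  have gL1 : g * L1 <= g * L by rewrite ler_pM2l// ltW.
  have gL20 : 0 <= g * L2 by rewrite mulr_ge0// ltW.
  have gdl : g * dl <= 1 by rewrite /dl mulrBr; lra.
  have gdl0 : 0 <= g * dl by rewrite mulr_ge0// ltW.
  have sdl0 : 0 <= 1 - g * dl by rewrite subr_ge0.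
  pose r := (1 - g * L2) `^ p.
  have r0 : 0 <= r by exact: powR_ge0.
  pose V := v n.+1 `^ p.
  have AV : A * V = (2 * C / dl * v n.+1) `^ p.
    by rewrite powRM// divr_ge0 ?(ltW dl0)// mulr_ge0.
  pose B w := r * ((1 - g * dl) * ipnorm ip (X n w) `^ p + g * dl * (A * V)).
  apply: (@le_trans _ _ (\int[P]_w (B w)%:E)%E).
    apply: ae_ge0_le_integral => //.
    - by move=> w _; rewrite lee_fin powR_ge0.
    - exact: measurable_moment.
    - by move=> w _; rewrite lee_fin /B mulr_ge0// addr_ge0// mulr_ge0 ?powR_ge0// mulr_ge0 ?powR_ge0.
    - apply/measurable_EFinP/measurable_funM => //; apply: measurable_funD => //.
      apply: measurable_funM => //.
      exact: (measurableT_comp (measurable_powR p) (measurable_ipnorm ip (coordXT n))).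
    apply: filterS (hCR n) => w hw _; rewrite lee_fin /B AV.
    apply: drift_powR => //.
    - exact: ltW.
    - exact: ipnorm_ge0.
    - exact: ipnorm_ge0.
    - lra.
    apply: (le_trans (Ybound n w hw)); apply: lerD.
      apply: (ipnorm_contraction hL' (ltW hL) (ltW g0)) => //; last by lra.
        exact: ha.
      exact: ha'.
    rewrite ler_wpM2l ?(ltW g0)// /C mulrAC ler_wpM2r//.
    by apply: (le_trans he); rewrite ler_wpM2r// le_max lexx orbT.
  rewrite /B -/V -/r.
  under eq_integral do rewrite EFinM EFinD EFinM.
  rewrite integralZl//; last first.
    apply: integrableD => //; last exact: finite_measure_integrable_cst.
    exact: integrableZl.
  rewrite integralD//; last 2 first.
    exact: integrableZl.
    exact: finite_measure_integrable_cst.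
  rewrite integralZl// mE integral_const.
  by rewrite -!EFinM.
(* The threshold of [moment_recursion_step] with [B = K2 * M]. *)
pose K3 := 2 * (2 * dl * A + K2 * M).
(* [kappa] is quantified inside the eventual statement, so the starting index is independent of it
   and [kappa] can be chosen afterwards. Indices start at [n.+1] because [v] is known to be positive
   only from 1 on. *)
have near_step : \forall n \near \oo, forall kappa, 0 <= kappa ->
    K3 <= dl * kappa ->
    m n.+1 <= kappa * v n.+1 `^ p -> m n.+2 <= kappa * v n.+2 `^ p.
  have gsmall c : 0 < c -> \forall n \near \oo, gamma n.+2 <= c.
    move=> c0; have := (cvgr0_norm_le _ hgamma0 _ c0).
    move=> -[N _ hN]; exists N => // n /= Nn.
    apply: le_trans (ler_norm _) (hN _ _) => /=.
    by rewrite (leq_trans Nn)// -addn2 leq_addr.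
  have hN2 (Q : nat -> Prop) k : (\forall n \near \oo, Q n) ->
      \forall n \near \oo, Q (n + k)%N.
    move=> -[N _ hN]; exists N => // n /= Nn.
    by apply: hN => /=; rewrite (leq_trans Nn)// leq_addr.
  (* Smallness of the step size: 1 for the noise bound, [L'] and [c3] for the contraction, [c4] to
     keep [1 - gamma * L2] at least 1/2. *)
  have g1 := gsmall _ ltr01.
  have g2 := gsmall _ hL'.
  have c3 : 0 < 2 * (L - L1) * L' / L.
    by rewrite divr_gt0// !mulr_gt0// subr_gt0.
  have g3 := gsmall _ c3.
  have c4 : 0 < (2 * L)^-1 by rewrite invr_gt0 mulr_gt0.
  have g4 := gsmall _ c4.
  have g5 := hN2 _ 2%N hCe.
  have g6 := hN2 _ 1%N hbb.
  apply: filterS2 (filterI g1 (filterI g2 g3)) (filterI g4 (filterI g5 g6)).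
  move=> n [{}g1 [{}g2 {}g3]] [{}g4 [{}g5 {}g6]] kappa kappa0 hkappa hm.
  rewrite addn2 in g5; rewrite addn1 in g6.
  have g0 : 0 < gamma n.+2 by exact: hgamma.
  have v1 : 0 < v n.+1 by exact: hc.
  have v2 : 0 < v n.+2 by exact: hc.
  rewrite ler_pdivlMr// in g3.
  have {}g4 : 2 * (gamma n.+2 * L) <= 1.
    by rewrite mulrCA -ler_pdivlMr ?mulr_gt0// div1r.
  rewrite ler_pdivrMr// in g5.
  have hy := ystep n.+1 g2 g3 g4 g5.
  have hms := mstep n.+1 g1.
  have gdl : gamma n.+2 * dl <= 1.
    have : gamma n.+2 * dl <= gamma n.+2 * L.
      by rewrite ler_pM2l// /dl; lra.
    lra.
  have gL20 : 0 <= gamma n.+2 * L2 by rewrite mulr_ge0// ltW.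
  have gL2 : gamma n.+2 * L2 <= gamma n.+2 * L by rewrite ler_pM2l// ltW.
  have r0 : 0 <= 1 - gamma n.+2 * L2 by lra.
  (* The last part of (c), multiplied out: one step shrinks [v] by a factor of at least
     [1 - gamma * L2]. *)
  have rV : (1 - gamma n.+2 * L2) * v n.+1 <= v n.+2.
    have : (v n.+1 - v n.+2) / v n.+1 <= gamma n.+2 * L2.
      rewrite -ler_pdivrMl//; apply: (le_trans g6).
      by rewrite le_max lexx orbT.
    by rewrite ler_pdivrMr//; lra.
  have Yf : (\int[P]_w (ipnorm ip (Y n.+1 w) `^ p)%:E)%E \is a fin_num.
    by apply: integrable_fin_num => //; exact: momY.
  apply: (@moment_recursion_step _ (gamma n.+2) dl A (K2 * M) kappa
    ((1 - gamma n.+2 * L2) `^ p) (m n.+1) _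
    (fine (\int[P]_w (ipnorm ip (Y n.+1 w) `^ p)%:E)%E) (v n.+1 `^ p)) => //.
  - exact: ltW.
  - exact: ltW.
  - exact: mulr_ge0.
  - have e1 : 1 `^ p = 1 :> R by rewrite powR1.
    rewrite powR_ge0/= -[leRHS]e1 ge0_ler_powR ?nnegrE//; lra.
  - exact: powR_ge0.
  - by rewrite -powRM ?(ltW v1)// ge0_ler_powR ?nnegrE ?mulr_ge0 ?(ltW v1) ?(ltW v2).
  - by rewrite -lee_fin fineK.
  rewrite -lee_fin -mE; apply: (le_trans hms).
  rewrite [leRHS]EFinD leeD//; first by rewrite EFinM fineK.
  have -> : gamma n.+2 * (K2 * M) * v n.+2 `^ p
      = gamma n.+2 * K2 * v n.+2 `^ p * M by ring.
  rewrite [leRHS]EFinM lee_wpmul2l//.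
  by rewrite lee_fin !mulr_ge0 ?powR_ge0// ltW.
have [N _ hN] := near_step.
(* The sum dominates each of the quotients at indices 1 to [N.+1], from which the recursion takes
   over; the term at 0 is only an extra nonnegative summand. *)
pose S := \sum_(i < N.+2) m i / v i `^ p.
have S0 : 0 <= S by apply: sumr_ge0 => i _; rewrite divr_ge0 ?powR_ge0.
pose kappa := K3 / dl + S.
have K30 : 0 <= K3.
  by rewrite /K3 mulr_ge0// addr_ge0 ?mulr_ge0// ltW.
have kappa0 : 0 <= kappa by rewrite addr_ge0// divr_ge0// ltW.
have K3kappa : K3 <= dl * kappa.
  rewrite /kappa mulrDr mulrCA mulfV ?gt_eqF// mulr1 lerDl mulr_ge0//.
  exact: ltW.
have vp k : 0 < v k.+1 `^ p by apply: powR_gt0; exact: hc.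
have bound n : m n.+1 <= kappa * v n.+1 `^ p.
  have init k : (k <= N)%N -> m k.+1 <= kappa * v k.+1 `^ p.
    move=> kN; rewrite -ler_pdivrMr// /kappa /S.
    have hk : (k.+1 < N.+2)%N by [].
    rewrite (bigD1 (Ordinal hk))//= addrCA lerDl addr_ge0//.
      by rewrite divr_ge0// ltW.
    by apply: sumr_ge0 => i _; rewrite divr_ge0 ?powR_ge0.
  elim: n => [|n IH]; first exact: init.
  by have [nN|Nn] := leqP n.+1 N; [exact: init|exact: (hN n Nn)].
(* The added 1 makes the final constant strictly positive, and the root undoes the [p]-th power. *)
clearbody kappa; exists ((kappa + 1) `^ p^-1); first by apply: powR_gt0; rewrite ltr_wpDl.
case=> // n _; rewrite unlock mE poweR_EFin lee_fin.
have -> : v n.+1 = (v n.+1 `^ p) `^ p^-1.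
  by rewrite -powRrM mulfV ?powRr1//; lra.
rewrite -powRM ?powR_ge0//; last by rewrite addr_ge0.
rewrite ge0_ler_powR ?nnegrE ?invr_ge0 ?mulr_ge0 ?addr_ge0 ?powR_ge0//.
by apply: (le_trans (bound n)); rewrite ler_wpM2r ?powR_ge0// lerDl.
Qed.
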